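(* The deterministic online algorithm $\mathrm{Det}$ (defined in the context) is $(2n-2)$-competitive when the graph is either a collection of lines or a collection of cliques. That is, for every node set $V$ with $|V|=n$ and every instance $\sigma=(\pi_0;G_0,\dots,G_k)$ on $V$ that is a line instance or a clique instance, and for any way of breaking ties in $\mathrm{Det}$, $$\mathrm{Det}(\sigma)\le (2n-2)\cdot\mathrm{Opt}(\sigma).$$
   Context: Let $V$ be a set of $n$ nodes. A permutation is a bijection $\pi:V\to\{1,\dots,n\}$. A MinLA of a graph $G=(V,E)$ is a permutation $\pi$ minimizing $\sum_{\{x,y\}\in E}|\pi(x)-\pi(y)|$ among all permutations. $d(\pi,\pi')$ is the Kendall tau distance: the minimum number of swaps of adjacent elements transforming $\pi$ into $\pi'$. An instance consists of an arbitrary initial permutation $\pi_0$ and a sequence $G_0,\dots,G_k$ of graphs on $V$ where $G_0$ has no edges. In a clique instance, every $G_i$ is a disjoint union of cliques (isolated nodes are cliques of size one) and $G_{i+1}$ is obtained from $G_i$ by merging exactly two cliques into one. In a line instance, every $G_i$ is a disjoint union of paths (isolated nodes are paths with one node) and $G_{i+1}$ is obtained from $G_i$ by adding one edge between two distinct components. Feasible solution: permutations $\pi_1,\dots,\pi_k$ such that $\pi_i$ is a MinLA of $G_i$ for each $i$; its cost is $\sum_{i=0}^{k-1}d(\pi_i,\pi_{i+1})$. An online algorithm must choose $\pi_i$ knowing only $\pi_0,G_0,\dots,G_i$. $\mathrm{Opt}(\sigma)$ is the minimum cost of a feasible solution of $\sigma$. A deterministic algorithm is $c$-competitive if its cost on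 every instance $\sigma$ is at most $c\cdot\mathrm{Opt}(\sigma)$. Algorithm $\mathrm{Det}$: when $G_i$ is revealed, choose as $\pi_i$ an arbitrary permutation minimizing $d(\pi_0,\pi)$ among all MinLAs $\pi$ of $G_i$. $\mathrm{Det}(\sigma)$ denotes its cost on $\sigma$. *)

(* Defs.v *)
From mathcomp Require Import all_boot all_fingroup.

Set Implicit Arguments.
Unset Strict Implicit.
Unset Printing Implicit Defensive.

(* Positions are numbered from 0, i.e. {0, .., n-1} with n = #|V| stands for
   {1, .., n}. An injection between sets of equal cardinality is a bijection. *)
Definition arrangement (V : finType) : Type :=
  {p : {ffun V -> 'I_#|V|} | injectiveb p}.

Definition pos (V : finType) (p : arrangement V) : V -> 'I_#|V| := val p.
Coercion pos : arrangement >-> Funclass.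

Definition adjacent_swap (V : finType) : rel (arrangement V) :=
  fun p q => [exists i : 'I_#|V|, exists j : 'I_#|V|,
    (i.+1 == j :> nat) && [forall x, q x == tperm i j (p x)]].

Definition swaps_in (V : finType) (p q : arrangement V) : pred nat :=
  fun m => [exists s : m.-tuple (arrangement V),
    path (@adjacent_swap V) p s && (last p s == q)].

Section SwapsConnect.

Variable V : finType.
Implicit Types (p q : arrangement V) (s t : {perm 'I_#|V|}).

Fact arrangement_inj p : injective p.
Proof. exact/injectiveP/(valP p). Qed.

Fact act_inj s p : injectiveb [ffun x => s (p x)].
Proof.
by apply/injectiveP=> x y; rewrite !ffunE => /perm_inj /arrangement_inj.
Qed.

Let act s p : arrangement V := Sub [ffun x => s (p x)] (act_inj s p).

Let actE s p x : act s p x = s (p x).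
Proof. by rewrite /pos SubK ffunE. Qed.

Let arrangement_ext p q : (forall x, p x = q x) -> p = q.
Proof. by move=> pq; apply/val_inj/ffunP. Qed.

Let ok s := forall p, connect (@adjacent_swap V) p (act s p).

Let ok1 : ok 1%g.
Proof.
move=> p; suff -> : act 1%g p = p by exact: connect0.
by apply: arrangement_ext => x; rewrite actE perm1.
Qed.

Let okM s t : ok s -> ok t -> ok (s * t)%g.
Proof.
move=> oks okt p; apply: connect_trans (oks p) _.
suff -> : act (s * t)%g p = act t (act s p) by exact: okt.
by apply: arrangement_ext => x; rewrite !actE permM.
Qed.

Let ok_adj (i j : 'I_#|V|) : i.+1 = j :> nat -> ok (tperm i j).
Proof.
move=> ij p; apply: connect1; apply/existsP; exists i; apply/existsP; exists j.
by apply/andP; split; [exact/eqP|apply/forallP => x; rewrite actE].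
Qed.

Let ok_lt (m : nat) (i j : 'I_#|V|) : i + m.+1 = j -> ok (tperm i j).
Proof.
elim: m j => [|m IHm] j ij; first by apply: ok_adj; rewrite -ij addn1.
have lt_k : i + m.+1 < #|V|.
  by apply: leq_trans (ltn_ord j); rewrite ltnS -ij leq_add2l.
pose k := Ordinal lt_k.
have kj : k.+1 = j :> nat by rewrite /= -ij [in RHS]addnS.
have ik : i != k by rewrite -val_eqE /= -[X in X == _]addn0 eqn_add2l.
have ij' : i != j by rewrite -val_eqE /= -ij -[X in X == _]addn0 eqn_add2l.
have -> : tperm i j = (tperm k j * tperm i k * tperm k j)%g.
  have := tpermJ i k (tperm k j); rewrite tpermL conjgE tpermV.
  by rewrite [tperm k j i]tpermD 1?eq_sym // -mulgA => <-.
by do !apply: okM; try exact: ok_adj; exact: IHm.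
Qed.

Let ok_tperm (i j : 'I_#|V|) : ok (tperm i j).
Proof.
wlog: i j / i <= j => [H|].
  by case/orP: (leq_total i j) => ?; [|rewrite tpermC]; exact: H.
rewrite leq_eqVlt => /orP[/eqP/val_inj->|lt_ij]; first by rewrite tperm1.
by apply: (@ok_lt (j - i.+1)); rewrite addnS -addSn subnKC.
Qed.

Fact adjacent_swap_connect p q : connect (@adjacent_swap V) p q.
Proof.
have [g pK gK] : bijective p.
  by apply: inj_card_bij (@arrangement_inj p) _; rewrite card_ord.
have s_inj : injective (fun i => q (g i)).
  by move=> i j /arrangement_inj /(can_inj gK).
have -> : q = act (perm s_inj) p.
  by apply: arrangement_ext => x; rewrite actE permE pK.
suff: ok (perm s_inj) by apply.
have [ts -> _] := prod_tpermP (perm s_inj).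
apply: (big_ind ok) => [||t _]; [exact: ok1|exact: okM|exact: ok_tperm].
Qed.

Fact swaps_in_ex p q : exists m, swaps_in p q m.
Proof.
have /connectP[s ps ->] := adjacent_swap_connect p q.
by exists (size s); apply/existsP; exists (in_tuple s); rewrite ps eqxx.
Qed.

End SwapsConnect.

Definition kendall_tau (V : finType) (p q : arrangement V) : nat :=
  ex_minn (swaps_in_ex p q).

Record sgraph (V : finType) : Type := SGraph {
  edge : rel V;
  edge_sym : symmetric edge;
  edge_irrefl : irreflexive edge
}.
Coercion edge : sgraph >-> rel.

(* Each edge {x, y} is counted once, with x its endpoint placed first. *)
Definition arrangement_cost (V : finType) (G : sgraph V) (p : arrangement V) :
    nat :=
  \sum_(x : V) \sum_(y : V | G x y && (p x < p y)) (p y - p x).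

Definition is_minla (V : finType) (G : sgraph V) : pred (arrangement V) :=
  fun p => [forall q, arrangement_cost G p <= arrangement_cost G q].

(* The graphs are G_0, .., G_k with k = steps; graph_at is irrelevant beyond
   index steps. *)
Record instance (V : finType) : Type := Instance {
  init : arrangement V;
  steps : nat;
  graph_at : nat -> sgraph V
}.

Definition edgeless (V : finType) (G : sgraph V) : Prop :=
  forall x y, ~~ G x y.

Definition disjoint_cliques (V : finType) (G : sgraph V) : Prop :=
  forall x y, connect G x y -> x != y -> G x y.

Definition merges_two_cliques (V : finType) (G G' : sgraph V) : Prop :=
  exists u v : V, ~~ connect G u v /\
    forall x y, G' x y = [|| G x y,
                             connect G u x && connect G v y
                           | connect G v x && connect G u y].

Definition clique_instance (V : finType) (I : instance V) : Prop :=
  [/\ edgeless (graph_at I 0),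
      forall i, i <= steps I -> disjoint_cliques (graph_at I i)
    & forall i, i < steps I ->
        merges_two_cliques (graph_at I i) (graph_at I i.+1)].

(* The component of every node u can be listed without repetition so that
   adjacency is exactly consecutiveness in the list. *)
Definition disjoint_paths (V : finType) (G : sgraph V) : Prop :=
  forall u : V, exists s : seq V,
    [/\ uniq s,
        forall x, (x \in s) = connect G u x
      & {in s &, forall x y, G x y = ((index x s).+1 == index y s)
                                  || ((index y s).+1 == index x s)}].

Definition adds_joining_edge (V : finType) (G G' : sgraph V) : Prop :=
  exists u v : V, ~~ connect G u v /\
    forall x y, G' x y = [|| G x y,
                             (x == u) && (y == v)
                           | (x == v) && (y == u)].

Definition line_instance (V : finType) (I : instance V) : Prop :=
  [/\ edgeless (graph_at I 0),
      forall i, i <= steps I -> disjoint_paths (graph_at I i)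
    & forall i, i < steps I ->
        adds_joining_edge (graph_at I i) (graph_at I i.+1)].

(* A solution (pi_1, .., pi_k) is a k-tuple s; its entry s_i (i < k) is
   pi_(i+1), and pi_i is the i-th item of init I :: s. *)
Definition solution (V : finType) (I : instance V) : Type :=
  (steps I).-tuple (arrangement V).

Definition feasible (V : finType) (I : instance V) (s : solution I) : bool :=
  [forall i : 'I_(steps I), is_minla (graph_at I i.+1) (tnth s i)].

Definition cost (V : finType) (I : instance V) (s : solution I) : nat :=
  \sum_(i < steps I)
    kendall_tau (nth (init I) (init I :: s) i) (nth (init I) (init I :: s) i.+1).

Definition feasible_with_cost (V : finType) (I : instance V) : pred nat :=
  fun m => [exists s : (steps I).-tuple (arrangement V),
    feasible (s : solution I) && (cost (s : solution I) == m)].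

Fact feasible_with_cost_ex (V : finType) (I : instance V) :
  exists m, feasible_with_cost I m.
Proof.
pose best i := [arg min_(p < init I) arrangement_cost (graph_at I i.+1) p].
pose s : solution I := [tuple best i | i < steps I].
exists (cost s); apply/existsP; exists s; rewrite eqxx andbT.
apply/forallP => i; rewrite tnth_mktuple /best.
by case: arg_minnP => // p _ minp; apply/forallP => q; apply: minp.
Qed.

Definition Opt (V : finType) (I : instance V) : nat :=
  ex_minn (feasible_with_cost_ex I).

Definition det_choice (V : finType) (p0 : arrangement V) (G : sgraph V)
    (p : arrangement V) : Prop :=
  is_minla G p /\
  forall q, is_minla G q -> kendall_tau p0 p <= kendall_tau p0 q.

(* s is a possible output of Det on I, for some way of breaking ties. *)
Definition det_solution (V : finType) (I : instance V) (s : solution I) : Prop :=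
  forall i : 'I_(steps I), det_choice (init I) (graph_at I i.+1) (tnth s i).

(* Main.v *)
(* Every permutation of Det is a MinLA closest to pi_0, hence it is no farther
   from pi_0 than the corresponding permutation of an optimal solution, which
   is itself within Opt of pi_0. By the triangle inequality through pi_0, each
   step of Det costs at most 2 Opt. Every step merges two components, so there
   are at most n - 1 steps. *)
Require Import Defs.
From mathcomp Require Import all_boot all_fingroup.

Set Implicit Arguments.
Unset Strict Implicit.
Unset Printing Implicit Defensive.

Section KendallTau.

Variable V : finType.
Implicit Types p q r : arrangement V.

Lemma adjacent_swap_sym : symmetric (@adjacent_swap V).
Proof.
suff H p q : adjacent_swap p q -> adjacent_swap q p.
  by move=> p q; apply/idP/idP; apply: H.
move=> /existsP[i /existsP[j /andP[ij /forallP pq]]].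
apply/existsP; exists i; apply/existsP; exists j; rewrite ij /=.
by apply/forallP => x; rewrite (eqP (pq x)) tpermK.
Qed.

Lemma swaps_inP p q m :
  reflect (exists s, [/\ path (@adjacent_swap V) p s, last p s = q & size s = m])
          (swaps_in p q m).
Proof.
apply: (iffP existsP) => [[s /andP[ps /eqP]]|[s [ps ls /eqP sz]]].
  by exists s; rewrite size_tuple.
by exists (Tuple sz); rewrite /= ps ls eqxx.
Qed.

Lemma swaps_in_kendall_tau p q : swaps_in p q (kendall_tau p q).
Proof. by rewrite /kendall_tau; case: ex_minnP. Qed.

Lemma kendall_tau_min p q m : swaps_in p q m -> kendall_tau p q <= m.
Proof. by rewrite /kendall_tau; case: ex_minnP => d _; apply. Qed.

Lemma kendall_tauxx p : kendall_tau p p = 0.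
Proof.
by apply/eqP; rewrite -leqn0; apply/kendall_tau_min/swaps_inP; exists [::].
Qed.

(** An adjacent swap is its own inverse, so a shortest swap sequence can be walked backwards. *)
Lemma kendall_tauC p q : kendall_tau p q = kendall_tau q p.
Proof.
suff H p' q' : kendall_tau p' q' <= kendall_tau q' p'.
  by apply/eqP; rewrite eqn_leq !H.
apply/kendall_tau_min; have /swaps_inP[s [ps <- <-]] := swaps_in_kendall_tau q' p'.
(* The start of a path is not listed in it: [belast] puts [q'] in front and drops the endpoint,
   which becomes the start of the reversed path. *)
apply/swaps_inP; exists (rev (belast q' s)).
split; last by rewrite size_rev size_belast.
  by rewrite rev_path (eq_path (e' := @adjacent_swap V)) // => x y;
    exact: adjacent_swap_sym.
by case: s {ps} => //= x s; rewrite rev_cons last_rcons.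
Qed.

Lemma kendall_tau_triangle q p r :
  kendall_tau p r <= kendall_tau p q + kendall_tau q r.
Proof.
have /swaps_inP[s [ps ls <-]] := swaps_in_kendall_tau p q.
have /swaps_inP[t [qt lt <-]] := swaps_in_kendall_tau q r.
apply/kendall_tau_min/swaps_inP; exists (s ++ t).
by rewrite cat_path last_cat size_cat ls ps qt.
Qed.

Lemma kendall_tau_telescope (f : nat -> arrangement V) n :
  kendall_tau (f 0) (f n) <= \sum_(i < n) kendall_tau (f i) (f i.+1).
Proof.
elim: n => [|n IHn]; first by rewrite kendall_tauxx.
rewrite big_ord_recr /=; apply: leq_trans (kendall_tau_triangle (f n) _ _) _.
by rewrite leq_add2r.
Qed.

End KendallTau.

Section Steps.

Variable V : finType.

(* [T] is a set of nodes meeting every component; each merge makes one of its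
   elements redundant. *)
Lemma merging_steps_le (G : nat -> sgraph V) k :
    (forall i, i < k -> subrel (G i) (G i.+1)) ->
    (forall i, i < k -> exists u v, ~~ connect (G i) u v /\ G i.+1 u v) ->
  k <= #|V|.-1.
Proof.
move=> sub_G merge_G.
have [T coverT cardT] : exists2 T : {set V},
    forall x, exists2 t, t \in T & connect (G k) t x & #|T| + k <= #|V|.
  elim: k => [|k IHk] in sub_G merge_G *.
    by exists setT => [x|]; [exists x|rewrite addn0 cardsT].
  have [i lt_ik|i lt_ik|T coverT cardT] := IHk.
  - by apply: sub_G; apply: ltnW.
  - by apply: merge_G; apply: ltnW.
  have [u [v [nuv uv]]] := merge_G k (leqnn _).
  have [a aT au] := coverT u; have [b bT bv] := coverT v.
  have symG i : connect_sym (G i) by apply/sym_connect_sym/edge_sym.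
  have subc x y : connect (G k) x y -> connect (G k.+1) x y.
    by apply: connect_sub => {}x {}y xy; apply/connect1/sub_G.
  have ab : a != b.
    apply: contraNneq nuv => eq_ab; apply: (@connect_trans _ _ a).
      by rewrite symG.
    by rewrite eq_ab.
  (* The new edge joins the components represented by [a] and [b], so whatever [b] reached is now
     reached from [a] through [u], [v] and [b]. *)
  exists (T :\ b) => [x|]; last first.
    by move: cardT; rewrite (cardsD1 b) bT addnS.
  have [t tT tx] := coverT x; have [eq_tb|tb] := eqVneq t b.
    exists a; first by rewrite !inE ab.
    apply: connect_trans (subc _ _ au) _; apply: connect_trans (connect1 uv) _.
    apply: (@connect_trans _ _ b); first by rewrite symG; apply: subc.
    by rewrite -eq_tb; apply: subc.
  by exists t; [rewrite !inE tb|apply: subc].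
(* For empty [V] the predecessor of 0 is 0, and the count forces [k = 0]. Otherwise [T] meets the
   component of [x], so it has an element, which accounts for the [- 1]. *)
have [x _|V0] := pickP V; last first.
  by move: cardT; rewrite (eq_card0 V0) leqn0 addn_eq0 => /andP[_ /eqP->].
have [t tT _] := coverT x.
have T_gt0 : 0 < #|T| by apply/card_gt0P; exists t.
rewrite -ltnS prednK; last by apply/card_gt0P; exists x.
by apply: leq_trans cardT; rewrite -add1n leq_add2r.
Qed.

(** Both kinds of step keep the old edges and make the chosen [u] and [v], from distinct components,
    adjacent; nothing else about lines or cliques matters. *)
Lemma instance_steps_le (I : instance V) :
  line_instance I \/ clique_instance I -> steps I <= #|V|.-1.
Proof.
case=> -[_ _ merges]; apply: (merging_steps_le (G := graph_at I)) => i
  /merges[u [v [nuv GE]]].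
- by move=> x y xy; rewrite GE xy.
- by exists u, v; rewrite GE !eqxx orbT.
- by move=> x y xy; rewrite GE xy.
- by exists u, v; rewrite GE !connect0 orbT.
Qed.

Variable I : instance V.

(** The first [i] moves already lead from [init I] to this permutation, and their cost is a partial
    sum of [cost t]. *)
Lemma kendall_tau_init_le_cost (t : solution I) i : i <= steps I ->
  kendall_tau (init I) (nth (init I) (init I :: t) i) <= cost t.
Proof.
move=> le_ik; pose f j := nth (init I) (init I :: t) j.
apply: leq_trans (kendall_tau_telescope f i) _.
pose F j := kendall_tau (f j) (f j.+1).
rewrite /cost -!(big_mkord xpredT F).
by rewrite (big_cat_nat (n := i) (p := steps I)) //= leq_addr.
Qed.

(** At the same index, an optimal solution [t] has a MinLA of the same graph, so it competes in the
    choice made by Det. Index 0 is [init I] itself, at distance 0. *)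
Lemma det_kendall_tau_init_le_Opt (s : solution I) i :
    det_solution s -> i <= steps I ->
  kendall_tau (init I) (nth (init I) (init I :: s) i) <= Opt I.
Proof.
move=> det_s; rewrite /Opt.
case: ex_minnP => m /existsP[t /andP[/forallP feas_t /eqP <-]] _ {m}.
case: i => [|i] lt_ik; first by rewrite kendall_tauxx.
apply: leq_trans (kendall_tau_init_le_cost t lt_ik).
have [_ /(_ _ (feas_t (Ordinal lt_ik)))] := det_s (Ordinal lt_ik).
by rewrite !(tnth_nth (init I)).
Qed.

End Steps.

Theorem theorem1 (V : finType) (I : instance V) (s : solution I)
    (hI : line_instance I \/ clique_instance I) (hs : det_solution s) :
  cost s <= (2 * #|V| - 2) * Opt I.
Proof.
(* With truncated subtraction this also holds for empty [V], where both sides are 0. *)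
have -> : 2 * #|V| - 2 = #|V|.-1 * 2 by rewrite -subn1 mulnBl mulnC.
rewrite -mulnA; apply: leq_trans (leq_mul (instance_steps_le hI) (leqnn _)).
(* The bound becomes a constant sum over the steps, leaving [2 * Opt I] to be shown for each
   move. *)
rewrite -[X in X * _]card_ord -sum_nat_const; apply: leq_sum => i _.
apply: leq_trans (kendall_tau_triangle (init I) _ _) _.
rewrite mul2n -addnn kendall_tauC.
apply: leq_add; apply: det_kendall_tau_init_le_Opt => //.
exact: ltnW.
Qed.
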